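(* For each $n$ let $G=G(n)$ be a graph on $n$ vertices with maximum degree at most $\Delta=\Delta(n)$ (where $\Delta$ is either constant or an increasing function of $n$) and girth $g=g(n)$, and let $L$ be a random $(k,\mathcal{C})$-list assignment for $G$, where $k$ is a fixed positive integer and $|\mathcal{C}|=\sigma=\sigma(n)$. Then: (i) if $k=2$, $g\ge C\log n$, where $C>0$ is a fixed constant, and $\sigma(n)\ge A\Delta\log n$, where $A=A(C)$ is a fixed constant satisfying $A>4e^{1/C}$, then with high probability $G$ is $L$-colorable; (ii) for each constant $C_2>0$, with the constants $k_0=\lceil \exp(2/C_2)+1\rceil$ and $B_0=\exp\left(\frac{k_0-2}{2}\right)k_0^2$, the following holds: if $g\ge C_2\log\log n$, $k\ge k_0$, $B>B_0$ is a constant and $\sigma(n)\ge B\Delta$, then with high probability $G$ is $L$-colorable.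
   Context: Graphs are finite and simple; the girth of a graph is the length of its shortest cycle; $\log$ is the natural logarithm. A list assignment $L$ for a graph $G$ assigns to each vertex $v$ a set $L(v)$ of colors. $G$ is $L$-colorable if there is a proper vertex coloring $\varphi$ of $G$ with $\varphi(v)\in L(v)$ for every $v\in V(G)$. A random $(k,\mathcal{C})$-list assignment for $G$, where $\mathcal{C}=\{1,2,\dots,\sigma\}$ (with $\sigma=\sigma(n)\ge k$), is obtained by choosing, for each vertex $v$, the list $L(v)$ independently and uniformly at random from all $k$-element subsets of $\mathcal{C}$. An event $A_n$ occurs with high probability if $\lim_{n\to\infty}\mathbb{P}[A_n]=1$. *)

(* Defs.v *)
From HB Require Import structures.
From mathcomp Require Import all_boot all_order all_algebra.
From mathcomp Require Import all_classical all_reals all_analysis.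

Set Implicit Arguments.
Unset Strict Implicit.
Unset Printing Implicit Defensive.

Import Order.TTheory GRing.Theory Num.Theory.
Import numFieldNormedType.Exports.

Local Open Scope classical_set_scope.
Local Open Scope ring_scope.

Record sgraph := SGraph {
  vertices :> finType;
  adj : rel vertices;
  adj_sym : symmetric adj;
  adj_irrefl : irreflexive adj }.

Arguments adj {s} _ _.

Definition degree (G : sgraph) (v : G) : nat := #|[set w : G | adj v w]%SET|.

Definition max_degree (G : sgraph) : nat := (\max_(v : G) degree v)%N.

Definition graph_cycle (G : sgraph) (c : seq G) : bool :=
  [&& (3 <= size c)%N, uniq c & cycle (@adj G) c].

(* The girth of a forest is +oo, the infimum of the empty set. *)
Definition girth (R : realType) (G : sgraph) : \bar R :=
  ereal_inf [set ((size c)%:R)%:E | c in [set c : seq G | graph_cycle c]].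

(* The color set {1, ..., sigma} is represented by 'I_sigma. *)
Definition list_assignment (G : sgraph) (sigma : nat) : finType :=
  {ffun G -> {set 'I_sigma}}.

Definition L_colorable (G : sgraph) (sigma : nat)
    (L : list_assignment G sigma) : bool :=
  [exists phi : {ffun G -> 'I_sigma},
    [forall v, phi v \in L v] &&
    [forall u, forall v, adj u v ==> (phi u != phi v)]].

Definition uniform_subset (R : realType) (sigma k : nat)
    (S : {set 'I_sigma}) : R :=
  if #|S| == k then ('C(sigma, k)%:R)^-1 else 0.

(* Independence of the lists: the law of a random (k, C)-list assignment is
   the product, over the vertices, of the uniform laws on k-subsets. *)
Definition random_list_mass (R : realType) (G : sgraph) (sigma k : nat)
    (L : list_assignment G sigma) : R :=
  \prod_(v : G) uniform_subset R k (L v).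

Definition list_prob (R : realType) (G : sgraph) (sigma k : nat)
    (E : pred (list_assignment G sigma)) : R :=
  \sum_(L : list_assignment G sigma | E L) random_list_mass R k L.

Definition whp_list (R : realType) (G : nat -> sgraph) (sigma : nat -> nat)
    (k : nat) (E : forall n, pred (list_assignment (G n) (sigma n))) : Prop :=
  (fun n => list_prob R k (@E n)) @ \oo --> (1 : R).

Definition k_zero (R : realType) (C2 : R) : nat :=
  `|Num.ceil (expR (2 / C2) + 1)|%N.

Definition B_zero (R : realType) (C2 : R) : R :=
  expR (((k_zero C2)%:R - 2) / 2) * (k_zero C2)%:R ^+ 2.

(* Main.v *)
Require Import Defs.
From HB Require Import structures.
From mathcomp Require Import all_boot all_order all_algebra.
From mathcomp Require Import all_classical all_reals all_analysis.
From mathcomp Require Import zify ring lra.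

Set Implicit Arguments.
Unset Strict Implicit.
Unset Printing Implicit Defensive.

Import Order.TTheory GRing.Theory Num.Theory.
Import numFieldNormedType.Exports.

Local Open Scope classical_set_scope.
Local Open Scope ring_scope.

(** Call two adjacent vertices linked when their lists meet.  If a graph cannot
be coloured from lists of size k, then, since greedy colouring fails, it has a
core: a nonempty vertex set in which every vertex has at least k linked
neighbours ([uncolorable_core]).  When the graph has girth at least g, a core
contains a copy of the Moore tree, in which every inner vertex has degree k and
all distances are at most g - 1: as long as distances from the vertex being
extended are at most g - 2, a new edge from it cannot return to the part built
so far without closing a cycle shorter than g, apart from the tree edges
already there, of which there are fewer than k ([grow_tree]).

Copies of a fixed tree with N edges are rare.  A root can be chosen in n ways
and each further vertex in at most D ways (D the maximum degree), and two
independent random k-subsets of sigma colours meet with probability at most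
k^2 / sigma; each new vertex brings a fresh list, so these factors multiply
([prob_extends]).  Hence the probability that no colouring exists is at most
n (D k^2 / sigma)^N ([prob_uncolorable]).

It remains to compare N with log n.  With q = k - 1, counting the Moore tree
gives ((q - 1) N + q + 1)^2 >= 4 q^g ([moore_bound]).  In the second part q is
at least exp(2 / C2), so q^g >= (log n)^2 and N >= (2 log n - q - 1) / (q - 1);
the bound on B makes the base of the power smaller than exp(- (q - 1) / 2), so
the bound tends to 0.  This is done for k = k_zero only; longer lists are
handled by choosing a uniformly random k_zero-subset of each list, which yields
a random assignment of lists of size k_zero and can only destroy colourings
([list_prob_sublists]).  In the first part q = 1, the tree is a path with
g - 1 >= C log n - 1 edges, and the base of the power is O(1 / log n),
eventually below exp(- 2 / C), which again suffices. *)

(** * The Moore tree and its embedding *)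

(** Breadth-first numbering of the tree in which every vertex has degree q + 1:
vertex 0 has the children 1, ..., q + 1, and vertex j > 0 has the children
q j + 2, ..., q j + q + 1.  Truncated subtraction makes 0 the parent of 1, so
the edge 01 obeys the same formula.  One numbering thus serves both for the tree
grown from the vertex 0 and for the tree grown from the edge 01. *)
Definition tree_parent (q m : nat) : nat := ((m - 2) %/ q)%N.

(** The largest vertex at distance at most r from the roots 0, ..., t: the tree
is grown from a vertex if t = 0 and from an edge if t = 1.  The last child of m
is q m + q + 1. *)
Definition tree_last (q t r : nat) : nat :=
  iter r (fun m => q * m + q + 1)%N t.

Definition tree_edge (q : nat) : rel nat := fun i j =>
  ((0 < j)%N && (i == tree_parent q j)) ||
  ((0 < i)%N && (j == tree_parent q i)).

Lemma tree_edgeC q : symmetric (tree_edge q).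
Proof. by move=> i j; rewrite /tree_edge orbC. Qed.

Lemma tree_parent_lt q m : (0 < m)%N -> (tree_parent q m < m)%N.
Proof.
move=> m0; have := leq_div (m - 2) q; rewrite /tree_parent; lia.
Qed.

Lemma tree_parent_le q m j : (0 < q)%N -> (m <= q * j + q + 1)%N ->
  (tree_parent q m <= j)%N.
Proof.
move=> q0 le_m; rewrite /tree_parent -ltnS ltn_divLR // mulSn mulnC; lia.
Qed.

Lemma tree_climb q t r i : (0 < q)%N -> (i <= tree_last q t r)%N ->
  exists w, [/\ path (tree_edge q) i w, (last i w <= t)%N, (size w <= r)%N &
                all (fun x => x <= i)%N w].
Proof.
move=> q0; elim: r i => [|r IHr] i; first by exists [::].
rewrite /tree_last iterS -/(tree_last q t r) => le_i.
case: (leqP i t) => [le_it|lt_ti]; first by exists [::].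
have i0 : (0 < i)%N by lia.
have [w [pw lw sw aw]] := IHr _ (tree_parent_le q0 le_i).
exists (tree_parent q i :: w); split => //=.
  by rewrite pw /tree_edge i0 eqxx orbT.
have lt_p := tree_parent_lt q i0; rewrite (ltnW lt_p) /=.
by apply: sub_all aw => x /leq_trans; apply; apply: ltnW.
Qed.

(** Climb from both ends to the roots; the two roots reached are equal, or are
joined by the edge 01 when t = 1.  Climbing decreases the numbers, so the walk
stays in the part of the tree that is present when its ends are. *)
Lemma tree_walk q t r1 r2 i j : (0 < q)%N -> (t <= 1)%N ->
    (i <= tree_last q t r1)%N -> (j <= tree_last q t r2)%N ->
  exists w, [/\ path (tree_edge q) i w, last i w = j,
                (size w <= r1 + r2 + t)%N & all (fun x => x <= maxn i j)%N w].
Proof.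
move=> q0 t1 /(tree_climb q0)[u [pu lu su au]].
move=> /(tree_climb q0)[v [pv lv sv av]].
have pv' : path (tree_edge q) (last j v) (rev (belast j v)).
  rewrite rev_path; apply: sub_path pv => x y.
  by rewrite tree_edgeC.
have lv' : last (last j v) (rev (belast j v)) = j.
  by case: (v) => //= x v'; rewrite rev_cons last_rcons.
have au' : all (fun x => x <= maxn i j)%N u.
  by apply: sub_all au => x /leq_trans; apply; apply: leq_maxl.
have av' : all (fun x => x <= maxn i j)%N (rev (belast j v)).
  rewrite all_rev; apply/allP => x /mem_belast; rewrite inE.
  move=> /orP[/eqP ->|/(allP av) /leq_trans]; first exact: leq_maxr.
  by apply; apply: leq_maxr.
case: (eqVneq (last i u) (last j v)) => [eq_uv|ne_uv].
  exists (u ++ rev (belast j v)); split.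
  - by rewrite cat_path pu eq_uv.
  - by rewrite last_cat eq_uv.
  - by rewrite size_cat size_rev size_belast; lia.
  - by rewrite all_cat au'.
exists (u ++ last j v :: rev (belast j v)); split.
- rewrite cat_path pu /= pv' andbT /tree_edge /tree_parent.
  have : (last i u = 0 /\ last j v = 1 \/ last i u = 1 /\ last j v = 0)%N.
    by move/eqP: ne_uv; lia.
  by case=> [[-> ->]|[-> ->]]; rewrite /= div0n.
- by rewrite last_cat.
- rewrite size_cat /= size_rev size_belast; move/eqP: ne_uv; lia.
- rewrite all_cat au' /= av' andbT.
  have : last j v \in j :: v by exact: mem_last.
  rewrite inE => /orP[/eqP ->|/(allP av) /leq_trans]; first exact: leq_maxr.
  by apply; apply: leq_maxr.
Qed.

(** Just before vertex m is attached, its parent has at most q tree neighbours: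
its own parent (or the vertex 1, when the parent of m is 0) and the children
that precede m. *)
Lemma tree_neighbours q m : (0 < q)%N ->
  exists2 l : seq nat, (size l <= q)%N &
    forall j, (j < m)%N -> tree_edge q (tree_parent q m) j -> j \in l.
Proof.
move=> q0; set p := tree_parent q m.
have m_ub : (m <= q * p + q + 1)%N.
  by have := ltn_ceil (m - 2) q0; rewrite -/(tree_parent q m) -/p; lia.
exists ((if p == 0 then 1 else tree_parent q p)%N ::
        iota (q * p + 2) (m - (q * p + 2))); first by rewrite /= size_iota; lia.
move=> j lt_jm /orP[/andP[j0 /eqP p_j]|/andP[p0 /eqP ->]]; last first.
  by rewrite inE -[p == _]negbK -lt0n p0 eqxx.
rewrite inE mem_iota.
have [j1|j2] := leqP j 1.
  have j_1 : j = 1%N by lia.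
  by rewrite p_j j_1 /tree_parent div0n.
have := leq_divM (j - 2) q; rewrite -/(tree_parent q j) -p_j.
by move=> ?; apply/orP; right; lia.
Qed.

(** The vertex x to be extended has more than q neighbours in S, hence one, w,
that is not a tree neighbour.  If w were the image s_j of a tree vertex, a tree
walk from x to s_j, which avoids the edge from x to s_j and has length at most
(r - 1) + r + t, would close with that edge a cycle shorter than 2 r + 1 + t. *)
Lemma grow_tree (G : sgraph) (e : rel G) (S : {set G}) (q t r : nat)
    (x0 : G) (s : seq G) :
    (0 < q)%N -> (t <= 1)%N -> subrel e (@adj G) ->
    (forall c : seq G, graph_cycle c -> (2 * r + 1 + t <= size c)%N) ->
    (forall v, v \in S -> (q < #|[set w in S | e v w]%SET|)%N) ->
    (0 < size s <= tree_last q t r)%N -> uniq s -> {subset s <= S} ->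
    (forall i, (0 < i < size s)%N ->
       adj (nth x0 s (tree_parent q i)) (nth x0 s i)) ->
  exists w, [/\ w \in S, w \notin s & e (nth x0 s (tree_parent q (size s))) w].
Proof.
move=> q0 t1 e_adj no_short S_deg /andP[s0 s_le] s_uniq sS s_tree.
set p := tree_parent q (size s); set x := nth x0 s p.
have lt_p : (p < size s)%N by exact: tree_parent_lt.
have xS : x \in S by apply: sS; apply: mem_nth.
have [l l_size l_nb] := tree_neighbours (size s) q0.
have /subsetPn[w] : ~~ ([set w in S | e x w]%SET \subset map (nth x0 s) l).
  apply/negP => /subset_leq_card /leq_trans /(_ (card_size _)).
  rewrite size_map => /leq_trans/(_ l_size).
  by rewrite leqNgt S_deg.
rewrite inE => /andP[wS xw] w_l; exists w; split => //; apply/negP => ws.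
set j := index w s; have lt_j : (j < size s)%N by rewrite index_mem.
have nth_j : nth x0 s j = w by exact: nth_index.
have not_edge : ~~ tree_edge q p j.
  by apply/negP => /(l_nb _ lt_j) jl; rewrite -nth_j map_f in w_l.
have ne_pj : p != j.
  apply/eqP => eq_pj; have := e_adj _ _ xw.
  by rewrite -nth_j -eq_pj adj_irrefl.
(* For r = 0 at most the vertex 0 is present, which is then x and w at once. *)
case: r no_short s_le => [|r] no_short s_le.
  by move: s_le; rewrite /tree_last /=; move/eqP: ne_pj; lia.
have le_p : (p <= tree_last q t r)%N by apply: tree_parent_le.
have le_j : (j <= tree_last q t r.+1)%N by apply: leq_trans s_le; apply: ltnW.
have [u [pu lu su au]] := tree_walk q0 t1 le_p le_j.
(* Shorten the walk to a path, to get a cycle without repeated vertices. *)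
move: lu; case/shortenP: pu => u' pu' u'_uniq u'_sub lu'.
have size_u' : (size u' <= size u)%N.
  by apply: uniq_leq_size => //; case/andP: u'_uniq.
have u'_lt i : i \in p :: u' -> (i < size s)%N.
  rewrite inE => /orP[/eqP -> //|/u'_sub /(allP au) /leq_ltn_trans]; apply.
  by rewrite gtn_max lt_p.
have u'_gt1 : (1 < size u')%N.
  case: (u') pu' lu' => [_ /eqP|i [|//]] /=; first by rewrite (negPf ne_pj).
  by rewrite andbT => /[swap] -> ; rewrite (negPf not_edge).
have map_adj : path (@adj G) x (map (nth x0 s) u').
  rewrite /x path_map; apply: (sub_in_path (P := [in p :: u'])) pu' => //.
  move=> a b /u'_lt a_lt /u'_lt b_lt /orP[] /andP[c0 /eqP eq_c] /=.
    by rewrite eq_c; apply: s_tree; rewrite c0.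
  by rewrite adj_sym eq_c; apply: s_tree; rewrite c0.
have /no_short : graph_cycle (map (nth x0 s) (p :: u')).
  apply/and3P; split; first by rewrite size_map.
    rewrite map_inj_in_uniq // => a b /u'_lt a_lt /u'_lt b_lt.
    by move/eqP; rewrite nth_uniq // => /eqP.
  by rewrite /= rcons_path map_adj last_map lu' nth_j adj_sym; apply: e_adj.
rewrite size_map /= => long.
suff: (2 * r.+1 + 1 + t <= (r + r.+1 + t).+1)%N by clear; lia.
by apply: leq_trans long _; rewrite ltnS; apply: leq_trans size_u' su.
Qed.

(** * Uncolorable assignments contain the tree *)

Definition linked (G : sgraph) (sigma : nat) (L : list_assignment G sigma) :
  rel G := fun u v => adj u v && ~~ [disjoint L u & L v].

(** Without a core, colour greedily: in each vertex set some vertex x has fewer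
than k linked neighbours, so after colouring the others a colour of L x is still
free; neighbours of x that are not linked to it cannot use a colour of L x. *)
Lemma uncolorable_core (G : sgraph) (sigma k : nat)
    (L : list_assignment G sigma) :
    (0 < k)%N -> (forall v, #|L v| = k) -> ~~ L_colorable L ->
  exists2 S : {set G}, (0 < #|S|)%N &
    forall v, v \in S -> (k <= #|[set w in S | linked L v w]%SET|)%N.
Proof.
move=> k0 L_card; apply: contraNP => no_core.
have L_ne v : exists c, c \in L v by apply/card_gt0P; rewrite L_card.
(* The colouring is total, with phi v in L v everywhere, but proper only on S;
   this provides a starting colouring for the empty set. *)
suff color_on (n : nat) (S : {set G}) : (#|S| <= n)%N ->
    exists phi : {ffun G -> 'I_sigma}, (forall v, phi v \in L v) /\
      {in S &, forall u v, adj u v -> phi u != phi v}.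
  have [phi [phiL phi_proper]] := color_on _ [set: G]%SET (leqnn _).
  apply/existsP; exists phi; apply/andP; split; first exact/forallP.
  by apply/'forall_forallP => u v; apply/implyP; apply: phi_proper; rewrite inE.
elim: n S => [|n IHn] S S_le.
  exists [ffun v => xchoose (L_ne v)]; split=> [v|u v].
    by rewrite ffunE; apply: xchooseP.
  by move: S_le; rewrite leqn0 => /eqP/cards0_eq ->; rewrite inE.
have [S0|[v vS]] := set_0Vmem S.
  by apply: IHn; rewrite S0 cards0.
have [x xS x_deg] : exists2 x,
    x \in S & (#|[set w in S | linked L x w]%SET| < k)%N.
  apply: contrapT => no_x; apply: no_core; exists S.
    by apply/card_gt0P; exists v.
  move=> x xS; rewrite leqNgt; apply/negP => ltx; apply: no_x.
  by exists x.
have [|phi [phiL phi_proper]] := IHn (S :\ x).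
  by move: S_le; rewrite (cardsD1 x) xS add1n ltnS.
have /subsetPn[c cL c_new] :
    ~~ (L x \subset [set phi w | w in [set w in S | linked L x w]%SET]%SET).
  apply/negP => /subset_leq_card /leq_trans /(_ (leq_imset_card _ _)).
  by rewrite L_card leqNgt x_deg.
have c_ok w : w \in S -> adj x w -> c != phi w.
  move=> wS xw; apply: contraNneq c_new => c_w; apply/imsetP; exists w => //.
  rewrite inE wS /linked xw /=; apply/pred0Pn; exists c => /=.
  by rewrite cL c_w phiL.
exists [ffun w => if w == x then c else phi w]; split=> [w|u w uS wS uw].
  by rewrite ffunE; case: eqP => [->|].
rewrite !ffunE.
case: (eqVneq u x) => [u_x|u_x]; case: (eqVneq w x) => [w_x|w_x].
- by rewrite u_x w_x adj_irrefl in uw.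
- by apply: c_ok => //; rewrite -u_x.
- by rewrite eq_sym; apply: c_ok => //; rewrite -w_x adj_sym.
- by apply: phi_proper => //; rewrite !inE ?u_x ?w_x.
Qed.

(** The partial copy s of the tree, listed in breadth-first order, can be
prolonged by j further vertices along linked edges.  The recursion adds one
vertex at a time so that the probability can be bounded one fresh list at a
time. *)
Fixpoint extends (G : sgraph) (sigma : nat) (L : list_assignment G sigma)
    (q : nat) (x0 : G) (j : nat) (s : seq G) : bool :=
  if j is j'.+1 then
    [exists w, [&& w \notin s,
                   linked L (nth x0 s (tree_parent q (size s))) w &
                   extends L q x0 j' (rcons s w)]]
  else true.

Lemma core_extends (G : sgraph) (sigma : nat) (L : list_assignment G sigma)
    (S : {set G}) (q t r : nat) (x0 : G) (j : nat) (s : seq G) :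
    (0 < q)%N -> (t <= 1)%N ->
    (forall c : seq G, graph_cycle c -> (2 * r + 1 + t <= size c)%N) ->
    (forall v, v \in S -> (q < #|[set w in S | linked L v w]%SET|)%N) ->
    (0 < size s)%N -> (size s + j <= (tree_last q t r).+1)%N ->
    uniq s -> {subset s <= S} ->
    (forall i, (0 < i < size s)%N ->
       adj (nth x0 s (tree_parent q i)) (nth x0 s i)) ->
  extends L q x0 j s.
Proof.
move=> q0 t1 no_short S_deg.
elim: j s => //= j IHj s s0 s_le s_uniq sS s_tree.
have linked_adj : subrel (linked L) (@adj G) by move=> u v /andP[].
have s_le' : (0 < size s <= tree_last q t r)%N.
  rewrite s0 /=; move: s_le; rewrite addnS ltnS.
  by apply: leq_trans; apply: leq_addr.
have [w [wS ws xw]] :=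
  grow_tree q0 t1 linked_adj no_short S_deg s_le' s_uniq sS s_tree.
apply/existsP; exists w; rewrite ws xw /=; apply: IHj.
- by rewrite size_rcons.
- by rewrite size_rcons addSnnS.
- by rewrite rcons_uniq ws.
- by move=> v; rewrite mem_rcons inE => /orP[/eqP ->|/sS].
move=> i; rewrite size_rcons ltnS => /andP[i0 le_i].
have lt_p := tree_parent_lt q i0.
rewrite !nth_rcons (leq_trans lt_p le_i).
case: (ltngtP i (size s)) le_i => // [lt_i _|i_s _].
  by apply: s_tree; rewrite i0.
by rewrite i_s; case/andP: xw.
Qed.

(** * The law of a random list assignment *)

Section RandomLists.

Variables (R : realType) (G : sgraph) (sigma k : nat).
Hypotheses (k_gt0 : (0 < k)%N) (k_le : (k <= sigma)%N).

Local Notation mass := (@random_list_mass R G sigma k).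
Local Notation unif := (@uniform_subset R sigma k).

Lemma binR_gt0 : (0 : R) < 'C(sigma, k)%:R.
Proof. by rewrite ltr0n bin_gt0. Qed.

Lemma uniform_subset_ge0 S : 0 <= unif S.
Proof. by rewrite /uniform_subset; case: eqP. Qed.

Lemma sum_uniform_subset (P : pred {set 'I_sigma}) :
  \sum_(S | P S) unif S =
  #|[set S : {set 'I_sigma} | P S & #|S| == k]%SET|%:R / 'C(sigma, k)%:R.
Proof.
rewrite /uniform_subset -big_mkcondr /= sumr_const mulr_natl.
by congr (_ *+ _); apply: eq_card => S; rewrite !inE.
Qed.

Lemma uniform_subset_sum1 : \sum_S unif S = 1.
Proof.
rewrite sum_uniform_subset; set A := [set S | _ & _]%SET.
have -> : #|A| = 'C(sigma, k).
  rewrite -[in RHS](card_ord sigma) -card_draws.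
  by apply: eq_card => S; rewrite !inE.
by rewrite divff // gt_eqF // binR_gt0.
Qed.

Lemma uniform_subset_mem (c : 'I_sigma) :
  \sum_(S : {set 'I_sigma} | c \in S) unif S = k%:R / sigma%:R.
Proof.
rewrite sum_uniform_subset; set A := [set S | _ & _]%SET.
have sigma_gt0 : (0 < sigma)%N by exact: leq_trans k_le.
have card_A : (sigma * #|A| = k * 'C(sigma, k))%N.
  have := card_draws 'I_sigma k; rewrite card_ord.
  rewrite -(cardsID [set S : {set 'I_sigma} | c \in S]%SET).
  have -> : [set S : {set 'I_sigma} | #|S| == k]%SET :&:
      [set S : {set 'I_sigma} | c \in S]%SET = A.
    by apply/setP => S; rewrite !inE andbC.
  (* The sets avoiding c are those contained in its complement. *)
  have -> : [set S : {set 'I_sigma} | #|S| == k]%SET :\: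
      [set S : {set 'I_sigma} | c \in S]%SET =
      [set S : {set 'I_sigma} | S \subset ~: [set c]%SET & #|S| == k]%SET.
    by apply/setP => S; rewrite !inE finset.subsetC finset.sub1set inE.
  rewrite cards_draws cardsC1 card_ord.
  move: #|A| => a; case: (sigma) sigma_gt0 => [//|n _].
  case: (k) k_gt0 => [//|m _]; rewrite /= binS addnC => /addnI ->.
  exact: mul_bin_diag.
have bin_ne0 : ('C(sigma, k)%:R : R) != 0 by rewrite gt_eqF // binR_gt0.
have sigma_ne0 : (sigma%:R : R) != 0 by rewrite pnatr_eq0 -lt0n.
apply/eqP; rewrite eqr_div //.
by rewrite -!natrM mulnC card_A.
Qed.

(** A union bound over the colours of T. *)
Lemma uniform_subset_meets (T : {set 'I_sigma}) :
  \sum_(S : {set 'I_sigma} | ~~ [disjoint T & S]) unif S <=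
  #|T|%:R * (k%:R / sigma%:R).
Proof.
have -> : #|T|%:R * (k%:R / sigma%:R) =
    \sum_(c in T) \sum_(S : {set 'I_sigma} | c \in S) unif S.
  by under eq_bigr do rewrite uniform_subset_mem; rewrite sumr_const mulr_natl.
under [leRHS]eq_bigr do rewrite big_mkcond /=.
rewrite exchange_big /= big_mkcond /=; apply: ler_sum => S _.
have ge0 c : 0 <= if c \in S then unif S else 0.
  by case: ifP => // _; apply: uniform_subset_ge0.
case: ifPn => [/pred0Pn[c /andP[/= cT cS]]|_]; last by apply: sumr_ge0.
by rewrite (bigD1 c) //= cS lerDl; apply: sumr_ge0.
Qed.

Lemma mass_ge0 L : 0 <= mass L.
Proof. by apply: prodr_ge0 => v _; apply: uniform_subset_ge0. Qed.

Lemma mass_card L v : mass L != 0 -> #|L v| = k.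
Proof.
rewrite /random_list_mass prodf_seq_neq0 => /allP/(_ v).
rewrite mem_index_enum => /(_ isT) /=; rewrite /uniform_subset.
by case: ifP => [/eqP|_] //; rewrite eqxx.
Qed.

Lemma sum_mass : \sum_L mass L = 1.
Proof.
rewrite /random_list_mass -(bigA_distr_bigA (fun (_ : G) S => unif S)) /=.
by rewrite big1 // => v _; apply: uniform_subset_sum1.
Qed.

Definition relist (L : list_assignment G sigma) (w : G) (S : {set 'I_sigma}) :
  list_assignment G sigma := [ffun v => if v == w then S else L v].

Lemma mass_relist L w S : mass (relist L w S) * unif (L w) = mass L * unif S.
Proof.
rewrite /random_list_mass (bigD1 w) //= [in RHS](bigD1 w) //= ffunE eqxx.
rewrite (eq_bigr (fun v => unif (L v))) => [|v /negPf v_w]; last first.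
  by rewrite ffunE v_w.
by rewrite mulrAC [RHS]mulrAC [unif S * _]mulrC.
Qed.

(** Independence of the list of w from the other lists: redrawing it does not
change an expectation.  Exchanging the old and the new list of w is an
involution that preserves the joint weight. *)
Lemma resample (w : G) (f : list_assignment G sigma -> R) :
  \sum_L mass L * f L = \sum_L mass L * \sum_S unif S * f (relist L w S).
Proof.
transitivity (\sum_L \sum_S mass L * unif S * f L).
  apply: eq_bigr => L _.
  by rewrite -mulr_suml -mulr_sumr uniform_subset_sum1 mulr1.
under [RHS]eq_bigr do rewrite mulr_sumr.
rewrite !pair_bigA /=.
pose swap (p : list_assignment G sigma * {set 'I_sigma}) :=
  (relist p.1 w p.2, p.1 w).
have swapK : involutive swap.
  move=> [L S]; rewrite /swap /=; congr pair; last by rewrite ffunE eqxx.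
  by apply/ffunP => v; rewrite !ffunE; case: eqP => [->|].
rewrite (reindex_inj (inv_inj swapK)) /=; apply: eq_bigr => p _.
by rewrite mass_relist mulrA.
Qed.

Lemma list_probE (E : pred (list_assignment G sigma)) :
  list_prob R k E = \sum_L mass L * (E L)%:R.
Proof.
rewrite /list_prob big_mkcond; apply: eq_bigr => L _.
by case: (E L); rewrite (mulr1, mulr0).
Qed.

Lemma list_prob_union (P : pred G) (E : pred (list_assignment G sigma))
    (F : G -> pred (list_assignment G sigma)) :
    (forall L, mass L != 0 -> E L -> exists2 w, P w & F w L) ->
  list_prob R k E <= \sum_(w | P w) list_prob R k (F w).
Proof.
move=> E_F; under eq_bigr do rewrite list_probE.
rewrite list_probE exchange_big /=; apply: ler_sum => L _.
have [->|L_ne0] := eqVneq (mass L) 0.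
  by rewrite mul0r big1 // => w _; rewrite mul0r.
rewrite -mulr_sumr ler_wpM2l ?mass_ge0 //.
case: (boolP (E L)) => [/(E_F _ L_ne0)[w Pw FwL]|_]; last first.
  by apply: sumr_ge0 => w _; apply: ler0n.
by rewrite (bigD1 w) //= FwL lerDl; apply: sumr_ge0 => v _; apply: ler0n.
Qed.

(** An event that ignores the list of w is unaffected when that list is redrawn,
and the new list meets the k-set L x with probability at most k k / sigma. *)
Lemma prob_linked (E : pred (list_assignment G sigma)) (x w : G) :
    x != w -> (forall L S, E (relist L w S) = E L) ->
  list_prob R k (fun L => E L && linked L x w) <=
  k%:R ^+ 2 / sigma%:R * list_prob R k E.
Proof.
move=> x_w E_w; rewrite !list_probE (resample w) mulr_sumr.
apply: ler_sum => L _; rewrite mulrCA.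
have [->|L_ne0] := eqVneq (mass L) 0; first by rewrite !mul0r.
apply: ler_wpM2l; first exact: mass_ge0.
case: (boolP (E L)) => EL; last first.
  by rewrite mulr0 big1 // => S _; rewrite E_w (negPf EL) mulr0.
rewrite mulr1 expr2 -mulrA.
have := uniform_subset_meets (L x); rewrite (mass_card x L_ne0).
apply: le_trans.
rewrite [leRHS]big_mkcond; apply: ler_sum => S _.
rewrite E_w EL /linked !ffunE eqxx (negPf x_w) /=.
case: ifP => _; rewrite ?andbF ?mulr0 // andbT.
by case: (adj x w); rewrite ?mulr1 ?mulr0 // uniform_subset_ge0.
Qed.

(** Induction on j, for an arbitrary event E that depends on the lists of s
only.  Choosing the next vertex w costs a factor max_degree G, and the link to w
is absorbed into E, which then depends on the lists of rcons s w. *)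
Lemma prob_extends (q : nat) (x0 : G) (j : nat) (s : seq G)
    (E : pred (list_assignment G sigma)) :
    (0 < size s)%N ->
    (forall L w S, w \notin s -> E (relist L w S) = E L) ->
  list_prob R k (fun L => E L && extends L q x0 j s) <=
  ((max_degree G)%:R * k%:R ^+ 2 / sigma%:R) ^+ j * list_prob R k E.
Proof.
elim: j s E => [|j IHj] s E s0 E_s.
  rewrite expr0 mul1r !list_probE; apply: ler_sum => L _.
  by rewrite /= andbT.
set x := nth x0 s (tree_parent q (size s)).
have xs : x \in s by apply: mem_nth; apply: tree_parent_lt.
pose F w L := [&& E L && linked L x w & extends L q x0 j (rcons s w)].
pose new w := (w \notin s) && adj x w.
apply: le_trans (@list_prob_union new _ F _) _.
  move=> L _ /andP[EL /existsP[w /and3P[ws xw w_ext]]].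
  by exists w; [rewrite /new ws; case/andP: xw | rewrite /F EL xw].
set rho := _ * _ / _; pose a : R := k%:R ^+ 2 / sigma%:R.
have rho_ge0 : 0 <= rho by rewrite /rho divr_ge0 // mulr_ge0 // exprn_ge0.
have a_ge0 : 0 <= a by rewrite /a divr_ge0 // exprn_ge0.
have PE_ge0 : 0 <= list_prob R k E by apply: sumr_ge0 => L _; apply: mass_ge0.
apply: (@le_trans _ _ (\sum_(w | new w) rho ^+ j * (a * list_prob R k E))).
  apply: ler_sum => w /andP[ws xw].
  apply: le_trans (IHj _ (fun L => E L && linked L x w) _ _) _.
  - by rewrite size_rcons.
  - move=> L v S; rewrite mem_rcons inE negb_or => /andP[v_w vs].
    rewrite E_s // /linked !ffunE eq_sym in v_w *; rewrite (negPf v_w).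
    by have /negPf -> : x != v by apply: contraNneq vs => <-.
  - rewrite ler_wpM2l ?exprn_ge0 //; apply: prob_linked => [|L S].
      by apply: contraNneq ws => <-.
    exact: E_s.
rewrite sumr_const -mulr_natl exprS.
have -> : rho ^+ j * (a * list_prob R k E) = a * (rho ^+ j * list_prob R k E).
  by rewrite mulrCA.
rewrite [leLHS]mulrA -[leRHS]mulrA ler_wpM2r ?mulr_ge0 ?exprn_ge0 //.
rewrite /rho -mulrA ler_wpM2r // ler_nat.
apply: leq_trans (leq_bigmax x); rewrite /degree.
by apply: subset_leq_card; apply/fintype.subsetP => w /andP[_ xw]; rewrite inE.
Qed.

Lemma prob_uncolorable (q t r : nat) :
    k = q.+1 -> (0 < q)%N -> (t <= 1)%N ->
    (forall c : seq G, graph_cycle c -> (2 * r + 1 + t <= size c)%N) ->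
  list_prob R k (fun L => ~~ @L_colorable G sigma L) <=
  #|G|%:R * ((max_degree G)%:R * k%:R ^+ 2 / sigma%:R) ^+ tree_last q t r.
Proof.
move=> k_q q0 t1 no_short.
pose F v L := true && @extends G sigma L q v (tree_last q t r) [:: v].
apply: le_trans (@list_prob_union predT _ F _) _.
  move=> L L_ne0 /(uncolorable_core k_gt0 (fun v => mass_card v L_ne0)).
  move=> [S /card_gt0P[v vS] S_deg]; exists v => //.
  apply: (core_extends (S := S) q0 t1 no_short) => //=.
  - by move=> w /S_deg; rewrite {1}k_q.
  - by move=> w; rewrite inE => /eqP ->.
  - by case.
rewrite -sum1_card natr_sum mulr_suml; apply: ler_sum => v _.
apply: le_trans (prob_extends _ _ _ _ _) _ => //.
rewrite mul1r; apply: ler_piMr.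
  by rewrite exprn_ge0 // divr_ge0 // mulr_ge0 // exprn_ge0.
by rewrite /list_prob sum_mass.
Qed.

Lemma list_prob_not (E : pred (list_assignment G sigma)) :
  list_prob R k E = 1 - list_prob R k (fun L => ~~ E L).
Proof.
apply/eqP; rewrite eq_sym subr_eq; apply/eqP.
by rewrite -sum_mass (bigID E).
Qed.

End RandomLists.

(** * Monotonicity in the size of the lists *)

Lemma card_supersets (sigma m k : nat) (T : {set 'I_sigma}) :
    #|T| = m -> (m <= k <= sigma)%N ->
  #|[set S : {set 'I_sigma} | T \subset S & #|S| == k]%SET| =
  'C(sigma - m, k - m).
Proof.
move=> T_m /andP[m_k k_sigma].
rewrite -(card_imset _ (inv_inj (@finset.setCK _))).
set A := imset _ _.
have -> : A =
    [set S : {set 'I_sigma} | S \subset ~: T & #|S| == (sigma - k)%N]%SET.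
  apply/setP => S; rewrite inE; apply/imsetP/idP => [[U]|/andP[ST /eqP S_k]].
    rewrite inE => /andP[TU /eqP U_k] ->.
    by rewrite finset.setCS TU cardsCs finset.setCK U_k card_ord eqxx.
  exists (~: S); last by rewrite finset.setCK.
  rewrite inE finset.subsetC ST cardsCs finset.setCK card_ord S_k subKn //.
  by rewrite eqxx.
rewrite cards_draws cardsCs finset.setCK card_ord T_m -bin_sub; last by lia.
by congr 'C(_, _); lia.
Qed.

(** Both sides count the pairs T, S with T in S, |T| = m and |S| = k; the proof
clears denominators. *)
Lemma bin_flag (sigma m k : nat) : (m <= k <= sigma)%N ->
  ('C(sigma, k) * 'C(k, m) = 'C(sigma, m) * 'C(sigma - m, k - m))%N.
Proof.
move=> /andP[m_k k_sigma]; have m_sigma := leq_trans m_k k_sigma.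
have pos : (0 < m`! * (k - m)`! * (sigma - k)`!)%N.
  by rewrite !muln_gt0 !fact_gt0.
apply/eqP; rewrite -(eqn_pmul2r pos); apply/eqP.
have e1 := bin_fact k_sigma; have e2 := bin_fact m_k.
have e3 := bin_fact m_sigma.
have e4 : ('C(sigma - m, k - m) * ((k - m)`! * (sigma - k)`!) =
           (sigma - m)`!)%N.
  have -> : (sigma - k = sigma - m - (k - m))%N by lia.
  by apply: bin_fact; lia.
transitivity (sigma`!); first by rewrite -e1 -e2; ring.
by rewrite -e3 -e4; ring.
Qed.

(** Coupling: J is the joint law, at one vertex, of a uniform k-set S and a
uniform m-subset T of S, and its marginals are the two uniform laws.  Under the
product of the laws J, the event E for the large lists implies E for the small
ones. *)
Lemma list_prob_sublists (R : realType) (G : sgraph) (sigma m k : nat)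
    (E : pred (list_assignment G sigma)) :
    (m <= k <= sigma)%N ->
    (forall L L' : list_assignment G sigma,
       (forall v, L' v \subset L v) -> E L -> E L') ->
  list_prob R k E <= list_prob R m E.
Proof.
move=> mk_sigma E_down; have [m_k k_sigma] := andP mk_sigma.
pose J (S T : {set 'I_sigma}) : R :=
  if [&& #|S| == k, #|T| == m & T \subset S]
  then ('C(sigma, k) * 'C(k, m))%:R^-1 else 0.
have J_ge0 S T : 0 <= J S T by rewrite /J; case: ifP.
have pos a b : (b <= a)%N -> ('C(a, b)%:R : R) != 0.
  by move=> ab; rewrite pnatr_eq0 -lt0n bin_gt0.
have sum_T S : \sum_T J S T = uniform_subset R k S.
  rewrite /uniform_subset /J; case: (eqVneq #|S| k) => S_k /=; last first.
    by rewrite big1.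
  rewrite -big_mkcond /= sumr_const natrM invfM.
  have -> : #|[pred T : {set 'I_sigma} | (#|T| == m) && (T \subset S)]| =
      'C(k, m).
    rewrite -[in RHS]S_k -cards_draws; apply: eq_card => T.
    by rewrite !inE andbC.
  by rewrite -[LHS]mulr_natr -mulrA mulVf ?mulr1 // pos.
have sum_S T : \sum_S J S T = uniform_subset R m T.
  rewrite /uniform_subset /J; case: (eqVneq #|T| m) => T_m /=; last first.
    by rewrite big1 // => S _; rewrite andbF.
  rewrite -big_mkcond /= sumr_const bin_flag // natrM invfM.
  have -> : #|[pred S : {set 'I_sigma} | (#|S| == k) && (T \subset S)]| =
      'C(sigma - m, k - m).
    rewrite -(card_supersets T_m mk_sigma); apply: eq_card => S.
    by rewrite !inE andbC.
  by rewrite -[LHS]mulr_natr -mulrA mulVf ?mulr1 // pos //; lia.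
rewrite /list_prob /random_list_mass.
under eq_bigr => L _.
  under eq_bigr => v _ do rewrite -sum_T.
  rewrite (bigA_distr_bigA (fun v T => J (L v) T)) /=.
  over.
under [leRHS]eq_bigr => L' _.
  under eq_bigr => v _ do rewrite -sum_S.
  rewrite (bigA_distr_bigA (fun v S => J S (L' v))) /=.
  over.
rewrite exchange_big [leRHS]big_mkcond /=; apply: ler_sum => L' _.
have ge0 (L : list_assignment G sigma) : 0 <= \prod_v J (L v) (L' v).
  by apply: prodr_ge0.
case: (boolP (E L')) => EL'.
  by rewrite big_mkcond; apply: ler_sum => L _; case: ifP => // _; apply: ge0.
rewrite big1 // => L EL; apply: contraNeq EL' => prod_ne0.
apply: E_down EL => v; move: prod_ne0.
rewrite prodf_seq_neq0 => /allP/(_ v); rewrite mem_index_enum => /(_ isT) /=.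
by rewrite /J; case: ifP => [/and3P[]|] //; rewrite eqxx.
Qed.

Lemma uncolorable_sublists (G : sgraph) (sigma : nat)
    (L L' : list_assignment G sigma) :
  (forall v, L' v \subset L v) -> ~~ L_colorable L -> ~~ L_colorable L'.
Proof.
move=> sub; apply: contra => /existsP[phi /andP[/forallP phiL phi_ok]].
apply/existsP; exists phi; rewrite phi_ok andbT; apply/forallP => v.
exact: (fintype.subsetP (sub v)).
Qed.

(** * Size of the tree and girth *)

(** The number of edges of the Moore tree for girth g.  If t = 0 for odd g and
t = 1 for even g > 0, and r = (g - 1) / 2 rounded down, then g = 2 r + 1 + t. *)
Definition tree_size (q g : nat) : nat := tree_last q (~~ odd g) (g.-1)./2.

Lemma tree_lastE q t r :
  (q * tree_last q.+1 t r + q + 2 = q.+1 ^ r * (t * q + q + 2))%N.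
Proof.
elim: r => [|r IHr]; first by rewrite /tree_last /= expn0; lia.
rewrite /tree_last iterS -/(tree_last q.+1 t r) expnS -mulnA -IHr.
by move: (tree_last _ _ _) => N; ring.
Qed.

Lemma tree_size_path g : (0 < g)%N -> tree_size 1 g = g.-1.
Proof.
have last1 t r : tree_last 1 t r = (t + r.*2)%N.
  elim: r => [|r IHr]; first by rewrite addn0.
  by rewrite /tree_last iterS -/(tree_last 1 t r) IHr; lia.
rewrite /tree_size last1; case: g => [|g] //= _.
by rewrite negbK odd_double_half.
Qed.

(** By [tree_lastE], the number squared is Q^r (Q + 1) for g = 2 r + 1 and
2 Q^(r + 1) for g = 2 r + 2, where Q = q + 1.  The second case is an equality;
the first one is (Q + 1)^2 >= 4 Q.  Squaring avoids half-integral powers. *)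
Lemma moore_bound q g : (0 < g)%N ->
  (4 * q.+1 ^ g <= (q * tree_size q.+1 g + q + 2) ^ 2)%N.
Proof.
case: g => // g _; rewrite /tree_size tree_lastE /= negbK.
rewrite -{1}(odd_double_half g) -muln2 expnMn -expnM.
case: (odd g) => /=; rewrite !expnS ?add0n ?add1n ?expnS expn0.
  by move: (q.+1 ^ _)%N => X; apply/eq_leq; ring.
move: (q.+1 ^ _)%N => X; rewrite mulnA mulnC.
by apply: leq_mul => //; nia.
Qed.

Lemma girth_ge (R : realType) (G : sgraph) (x : R) : 0 < x ->
    (x%:E <= girth R G)%E ->
  forall c : seq G, graph_cycle c -> (`|Num.ceil x| <= size c)%N.
Proof.
move=> x0 x_girth c c_cycle.
have : (x%:E <= ((size c)%:R)%:E)%E.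
  by apply: le_trans x_girth _; apply: ereal_inf_lbound; exists c.
rewrite lee_fin => x_c.
have : (Num.ceil x <= (size c)%:Z)%R by rewrite ceil_le_int.
have : 0 < Num.ceil x by rewrite ceil_gt0.
by move: (Num.ceil x) (size c) => z m; lia.
Qed.

Lemma abs_ceil_ge (R : realType) (x : R) : 0 < x -> x <= (`|Num.ceil x|%N)%:R.
Proof.
move=> x0; rewrite natr_absz ger0_norm ?ceil_ge //.
by rewrite ltW // ceil_gt0.
Qed.

(** The bound for a fixed graph.  The tree may be taken for any list size
q + 1 <= k, the lists being shortened beforehand. *)
Lemma prob_colorable_ge (R : realType) (G : sgraph) (sigma k q : nat) (x : R) :
    (0 < q < k)%N -> (k <= sigma)%N -> 0 < x -> (x%:E <= girth R G)%E ->
  1 - #|G|%:R * ((max_degree G)%:R * q.+1%:R ^+ 2 / sigma%:R)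
                  ^+ tree_size q `|Num.ceil x|
    <= list_prob R k (@L_colorable G sigma).
Proof.
move=> /andP[q0 q_k] k_sigma x0 x_girth.
have k0 : (0 < k)%N by exact: leq_trans q_k.
have q_sigma : (q < sigma)%N by exact: leq_trans k_sigma.
rewrite (list_prob_not _ k_sigma) lerD2l lerN2.
apply: le_trans (list_prob_sublists _ _ _) _.
- by apply/andP; split; [exact: q_k|].
- by move=> L L'; apply: uncolorable_sublists.
apply: prob_uncolorable => //; first by case: (odd _).
move=> c /(girth_ge x0 x_girth); apply: leq_trans.
have : (0 < `|Num.ceil x|)%N by rewrite absz_gt0 gt_eqF // ceil_gt0.
case: `|_|%N => //= g _; rewrite negbK.
by have := odd_double_half g; lia.
Qed.

Lemma list_prob_le1 (R : realType) (G : sgraph) (sigma k : nat)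
    (E : pred (list_assignment G sigma)) :
  (k <= sigma)%N -> list_prob R k E <= 1.
Proof.
move=> k_sigma; rewrite (list_prob_not _ k_sigma) gerBl.
by apply: sumr_ge0 => L _; apply: mass_ge0.
Qed.

(** * Asymptotics *)

Lemma near_ln (R : realType) (a : R) : \forall n \near \oo, a <= ln (n%:R : R).
Proof.
near=> n; rewrite -[a]expRK ler_ln ?posrE ?expR_gt0 //.
  by near: n; apply: nbhs_infty_ger.
apply: lt_le_trans (expR_gt0 a) _.
by near: n; apply: nbhs_infty_ger.
Unshelve. all: by end_near. Qed.

(** With n = exp (ln n), the failure probability n rho^N is at most
exp (ln n - b N) when rho <= exp (- b); this tends to 0 when it is at most
exp (c - d ln n) with d > 0. *)
Lemma whp_colorable (R : realType) (G : nat -> sgraph) (sigma : nat -> nat)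
    (k q : nat) (x : nat -> R) (b c d : R) :
    (forall n, #|vertices (G n)| = n) -> (0 < q < k)%N ->
    (forall n, (k <= sigma n)%N) ->
    (forall n, ((x n)%:E <= girth R (G n))%E) -> 0 < d ->
    (\forall n \near \oo, [/\ 0 < x n,
       (max_degree (G n))%:R * q.+1%:R ^+ 2 / (sigma n)%:R <= expR (- b) &
       ln (n%:R : R) - b * (tree_size q `|Num.ceil (x n)|)%:R
         <= c - d * ln (n%:R : R)]) ->
  whp_list R k (fun n => @L_colorable (G n) (sigma n)).
Proof.
move=> cardG qk k_sigma x_girth d0 bound.
apply/cvgrPdist_le => e e0; near=> n.
have [x0 rho_le exp_le] : [/\ 0 < x n,
   (max_degree (G n))%:R * q.+1%:R ^+ 2 / (sigma n)%:R <= expR (- b) &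
   ln (n%:R : R) - b * (tree_size q `|Num.ceil (x n)|)%:R
     <= c - d * ln (n%:R : R)] by near: n.
have n0 : (0 : R) < n%:R.
  by apply: lt_le_trans ltr01 _; near: n; apply: nbhs_infty_ger.
rewrite ger0_norm ?subr_ge0 ?list_prob_le1 // lerBlDr addrC -lerBlDr.
apply: le_trans _ (prob_colorable_ge qk (k_sigma n) x0 (x_girth n)).
rewrite lerD2l lerN2 cardG -[X in X * _](lnK (x := n%:R)) //.
set N := tree_size _ _ in exp_le *.
apply: (@le_trans _ _ (expR (ln n%:R) * expR (- b) ^+ N)).
  apply: ler_wpM2l; first exact: expR_ge0.
  apply: lerXn2r rho_le; rewrite nnegrE; last exact: expR_ge0.
  by rewrite divr_ge0 // mulr_ge0 // exprn_ge0.
rewrite -expRM_natr -expRD -[e]lnK ?posrE // ler_expR mulNr.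
apply: le_trans exp_le _; rewrite lerBlDr -lerBlDl -ler_pdivrMl //.
by near: n; apply: near_ln.
Unshelve. all: by end_near. Qed.

Lemma exponent_le (R : realFieldType) (a l x y : R) : 0 <= a ->
  2 * l <= x + y + 2 -> l - a / 2 * x <= a * (y + 2) / 2 - (a - 1) * l.
Proof. by move=> a0 /(ler_wpM2l a0); lra. Qed.

Theorem proposition4p6 (R : realType) (G : nat -> sgraph) (Delta : nat -> R)
    (sigma : nat -> nat) (k : nat)
    (hG : forall n, #|vertices (G n)| = n)
    (hDelta : forall n, (max_degree (G n))%:R <= Delta n)
    (hDelta_mono : (exists d : R, forall n, Delta n = d) \/
                   (forall m n : nat, (m <= n)%N -> Delta m <= Delta n))
    (hk : (0 < k)%N)
    (hsigma : forall n, (k <= sigma n)%N) :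
  (forall C A : R, 0 < C -> 4 * expR (1 / C) < A ->
     k = 2%N ->
     (forall n, ((C * ln (n%:R : R))%:E <= girth R (G n))%E) ->
     (forall n, A * Delta n * ln (n%:R : R) <= (sigma n)%:R) ->
     whp_list R k (fun n => @L_colorable (G n) (sigma n)))
  /\
  (forall C2 : R, 0 < C2 ->
     forall B : R, B_zero C2 < B ->
     (k_zero C2 <= k)%N ->
     (forall n, ((C2 * ln (ln (n%:R : R)))%:E <= girth R (G n))%E) ->
     (forall n, B * Delta n <= (sigma n)%:R) ->
     whp_list R k (fun n => @L_colorable (G n) (sigma n))).
Proof.
have sigma_gt0 n : (0 : R) < (sigma n)%:R by rewrite ltr0n (leq_trans hk).
have ratio_le n (m D : R) : 0 <= m -> 0 < D -> D * Delta n <= (sigma n)%:R ->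
    (max_degree (G n))%:R * m / (sigma n)%:R <= m / D.
  move=> m0 D0 D_sigma; rewrite ler_pdivrMr // mulrAC ler_pdivlMr //.
  rewrite [leLHS]mulrAC [leLHS]mulrC ler_wpM2l //.
  by apply: le_trans D_sigma; rewrite mulrC ler_wpM2l // ltW.
split.
- move=> C A C0 A_gt k2 girth_C sigma_A.
  have A0 : 0 < A by apply: lt_trans A_gt; rewrite mulr_gt0 // expR_gt0.
  apply: (whp_colorable (q := 1) (x := fun n => C * ln n%:R)
            (b := 2 / C) (c := 2 / C) (d := 1)) => //; first by rewrite k2.
  near=> n.
  have l0 : 0 < ln (n%:R : R).
    by apply: lt_le_trans ltr01 _; near: n; apply: near_ln.
  have x0 : 0 < C * ln (n%:R : R) by rewrite mulr_gt0.
  split => //.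
    apply: (@le_trans _ _ (2 ^+ 2 / (A * ln n%:R))).
      by apply: ratio_le; rewrite ?exprn_ge0 ?mulr_gt0 // mulrAC.
    (* 4 / (A ln n) <= exp (- 2 / C) as soon as ln n >= 4 exp (2 / C) / A. *)
    rewrite expRN ler_pdivrMr ?mulr_gt0 // mulrC ler_pdivlMr ?expR_gt0 //.
    rewrite -ler_pdivrMl //.
    by near: n; apply: near_ln.
  have /abs_ceil_ge := x0; set g := `|_|%N => g_ge.
  have g0 : (0 < g)%N by rewrite -(ltr_nat R); lra.
  rewrite tree_size_path // mul1r.
  have g_le : g%:R <= (g.-1)%:R + 1 :> R by rewrite natr1 ler_nat; lia.
  have : 2 / C * (C * ln (n%:R : R) - 1) <= 2 / C * (g.-1)%:R.
    apply: ler_wpM2l; first by rewrite divr_ge0 // ltW.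
    by rewrite lerBlDr; apply: le_trans g_le.
  have -> : 2 / C * (C * ln (n%:R : R) - 1) = 2 * ln (n%:R : R) - 2 / C.
    by field; rewrite gt_eqF.
  lra.
- move=> C2 C2_gt0 B B_gt k0_le girth_C sigma_B.
  have k0_ge : expR (2 / C2) + 1 <= (k_zero C2)%:R.
    by apply: abs_ceil_ge; rewrite addr_gt0 ?expR_gt0.
  have exp_gt1 : 1 < expR (2 / C2) by rewrite expR_gt1 divr_gt0.
  have k0_gt2 : (2 < k_zero C2)%N by rewrite -(ltr_nat R); lra.
  rewrite /B_zero in B_gt; move: (k_zero C2) => k0 in B_gt k0_le k0_ge k0_gt2.
  (* From here on k_zero C2 = q + 2, so inner vertices have q + 1 children. *)
  case: k0 => [//|[//|q]] in B_gt k0_le k0_ge k0_gt2.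
  have q0 : (0 : R) < q%:R by rewrite ltr0n; lia.
  have sq0 : (0 : R) < q.+2%:R ^+ 2 by rewrite exprn_gt0.
  have B0 : 0 < B by apply: lt_trans B_gt; rewrite mulr_gt0 // expR_gt0.
  pose b : R := ln (B / q.+2%:R ^+ 2).
  have b_gt : q%:R / 2 < b.
    rewrite -[_ / 2]expRK ltr_ln ?posrE ?expR_gt0 ?divr_gt0 //.
    rewrite ltr_pdivlMr //; apply: le_lt_trans B_gt.
    by rewrite -[q.+2]addn2 natrD addrK.
  (* b N = (a / 2) (q N) and q N >= 2 ln n - (q + 2), so the surplus a - 1 > 0
     of the rate is what beats the factor n. *)
  pose a := 2 * b / q%:R.
  have a_gt1 : 1 < a by rewrite /a ltr_pdivlMr //; lra.
  apply: (whp_colorable (q := q.+1) (x := fun n => C2 * ln (ln n%:R))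
            (b := b) (c := a * (q%:R + 2) / 2) (d := a - 1)) => //.
    by rewrite subr_gt0.
  near=> n.
  have l_gt1 : 1 < ln (n%:R : R).
    by apply: (@lt_le_trans _ _ 2); [lra | near: n; apply: near_ln].
  set l := ln (n%:R : R) in l_gt1 *.
  have x0 : 0 < C2 * ln l by rewrite mulr_gt0 // ln_gt0.
  split => //.
    rewrite expRN /b lnK ?posrE ?divr_gt0 // invf_div.
    by apply: ratio_le => //; apply: ltW.
  have /abs_ceil_ge := x0; set g := `|_|%N => g_ge.
  set N := tree_size q.+1 g.
  have g0 : (0 < g)%N by rewrite -(ltr_nat R); lra.
  have exp_g : l ^+ 2 <= q.+1%:R ^+ g.
    apply: (@le_trans _ _ (expR (2 / C2) ^+ g)); last first.
      apply: lerXn2r; rewrite ?nnegrE ?expR_ge0 //.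
      by rewrite -[q.+2]addn1 natrD in k0_ge; lra.
    rewrite -[l in leLHS]lnK ?posrE; last by lra.
    rewrite -!expRM_natr ler_expR mulrC.
    have -> : 2 * ln l = 2 / C2 * (C2 * ln l) by field; rewrite gt_eqF.
    by rewrite ler_wpM2l // divr_ge0 // ltW.
  have N_ge : 2 * l <= q%:R * N%:R + q%:R + 2.
    have lhs0 : 0 <= 2 * l by rewrite mulr_ge0 // ltW // (lt_trans ltr01).
    have rhs0 : 0 <= q%:R * N%:R + q%:R + 2 :> R.
      by rewrite !addr_ge0 // mulr_ge0.
    rewrite -(@ler_pXn2r _ 2) ?nnegrE //.
    rewrite exprMn; apply: (@le_trans _ _ (2 ^+ 2 * q.+1%:R ^+ g)).
      by rewrite ler_wpM2l // exprn_ge0.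
    rewrite -!natrX -!natrM -!natrD -natrX ler_nat.
    exact: moore_bound.
  have -> : b * N%:R = a / 2 * (q%:R * N%:R).
    by rewrite /a; field; rewrite gt_eqF.
  by apply: exponent_le => //; apply: ltW (lt_trans ltr01 a_gt1).
Unshelve. all: by end_near. Qed.
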